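(* Let $X$ be a locally convex Hausdorff topological vector space, let $g:X\to\overline{\mathbb R}$ be a proper and convex function, $h:X\to\overline{\mathbb R}$ a proper generalized polyhedral convex function, and $C\subset X$ a nonempty convex set, with $(\mathrm{dom}\,g)\cap C\neq\emptyset$. Consider the problem of minimizing $f(x):=g(x)-h(x)$ over $x\in C$. Then a point $\bar x\in \mathrm{dom}\,g\cap [\mathrm{int}(\mathrm{dom}\,h)]\cap C$ is a local solution of this problem if and only if $$\partial h(\bar x)\subset \partial (g+\delta_C)(\bar x).$$ Thus, the equality $\mathcal S_1=\mathcal S_2$ is valid, where $\mathcal S_1$ is the set of local solutions and $\mathcal S_2$ is the set of stationary points of the problem.
   Context: $\overline{\mathbb R}=\mathbb R\cup\{\pm\infty\}$, with the convention $(+\infty)-(+\infty)=+\infty$. $X^*$ is the topological dual of $X$. For $\varphi:X\to\overline{\mathbb R}$, $\mathrm{dom}\,\varphi=\{x\mid \varphi(x)<+\infty\}$ and $\mathrm{epi}\,\varphi=\{(x,\alpha)\in X\times\mathbb R\mid x\in\mathrm{dom}\,\varphi,\ \varphi(x)\le\alpha\}$; $\varphi$ is proper if $\mathrm{dom}\,\varphi\ne\emptyset$ and $\varphi>-\infty$ everywhere, and convex if $\mathrm{epi}\,\varphi$ is convex. $\mathrm{int}$ denotes interior. A subset of a locally convex Hausdorff topological vector space $Z$ is generalized polyhedral convex if it has the form $\{z\in L\mid \langle z_k^*,z\rangle\le\alpha_k,\ k=1,\dots,p\}$ with $L\subset Z$ a closed affine subspace, $z_k^*\in Z^*$, $\alpha_k\in\mathbb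 R$. A function $\varphi:X\to\overline{\mathbb R}$ is generalized polyhedral convex if $\mathrm{epi}\,\varphi$ is a generalized polyhedral convex set in $X\times\mathbb R$. For a proper convex $\varphi$ and $\bar x\in\mathrm{dom}\,\varphi$, $\partial\varphi(\bar x)=\{x^*\in X^*\mid \langle x^*,x-\bar x\rangle\le\varphi(x)-\varphi(\bar x)\ \forall x\in X\}$. $\delta_C$ is the indicator function of $C$ ($0$ on $C$, $+\infty$ off $C$). A point $\bar x\in C$ is a local solution if there is a neighborhood $U$ of $\bar x$ with $f(\bar x)\le f(x)$ for all $x\in C\cap U$; $\mathcal S_1$ is the set of local solutions. $\mathcal S_2$ is the set of stationary points, i.e. of the points $\bar x\in\mathrm{dom}\,g\cap\mathrm{dom}\,h\cap C$ with $\partial h(\bar x)\subset\partial(g+\delta_C)(\bar x)$.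
   Formalization: The equality S_1 = S_2 is stated with S_1 restricted to local solutions in dom g ∩ dom h; unrestricted it fails, e.g. X = C = R, h = 0, g the indicator function of [0,1]: the point 5 is a local solution (f = +∞ nearby) but is not in dom g. *)

(* Defs.v *)
From HB Require Import structures.
From mathcomp Require Import all_boot all_order all_algebra.
From mathcomp Require Import boolp classical_sets reals ereal topology convex.
From mathcomp Require Import normedtype.

Set Implicit Arguments.
Unset Strict Implicit.
Unset Printing Implicit Defensive.

Import Order.TTheory GRing.Theory Num.Theory.
Import numFieldNormedType.Exports.

Local Open Scope classical_set_scope.
Local Open Scope ring_scope.

(* In MathComp-Analysis, a [tvsType R] is a locally convex topological vector
   space, not assumed to be Hausdorff. *)

Definition dual (R : realType) (Z : tvsType R) : set {linear Z -> R^o} :=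
  [set u | continuous u].

Definition affine_subspace (R : realType) (Z : tvsType R) (L : set Z) : Prop :=
  forall (x y : Z) (t : R), L x -> L y -> L ((1 - t) *: x + t *: y).

Definition gen_polyhedral_set (R : realType) (Z : tvsType R) (D : set Z)
    : Prop :=
  exists (L : set Z) (p : nat) (u : 'I_p -> {linear Z -> R^o}) (a : 'I_p -> R),
    [/\ closed L, affine_subspace L, forall k, dual (u k)
      & D = [set z | L z /\ forall k, u k z <= a k]].

Section ExtendedRealFunctions.
Context (R : realType) (X : tvsType R).
Implicit Types (phi g h : X -> \bar R) (C : set X) (x : X).

Definition dom phi : set X := [set x | (phi x < +oo)%E].

Definition epi phi : set (X * R^o) :=
  [set z | dom phi z.1 /\ (phi z.1 <= (z.2 : R)%:E)%E].

Definition proper_fun phi : Prop := dom phi !=set0 /\ forall x, (-oo < phi x)%E.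

Definition convex_fun phi : Prop :=
  convex_set (epi phi : set (convex_lmodType (X * R^o)%type)).

Definition gen_polyhedral_fun phi : Prop := gen_polyhedral_set (epi phi).

(* Only meaningful for [dom phi x]. *)
Definition subdifferential phi x : set {linear X -> R^o} :=
  [set u | dual u /\ forall y, ((u (y - x) : R)%:E <= phi y - phi x)%E].

Definition indicator C x : \bar R := if x \in C then 0%E else +oo%E.

(* The dual addition of [\bar R] satisfies (+oo) - (+oo) = +oo, whereas the
   default one gives -oo. *)
Definition dc_objective g h x : \bar R := (g x - h x)%dE.

Definition local_solutions g h C : set X :=
  [set x | C x /\ exists2 U : set X, nbhs x U &
     forall y, (C `&` U) y -> (dc_objective g h x <= dc_objective g h y)%E].

Definition stationary_points g h C : set X :=
  [set x | (dom g `&` dom h `&` C) x /\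
     subdifferential h x `<=` subdifferential (g \+ indicator C)%E x].

End ExtendedRealFunctions.

(* Main.v *)
Require Import Defs.
From HB Require Import structures.
From mathcomp Require Import all_boot all_order all_algebra.
From mathcomp Require Import boolp classical_sets reals ereal topology convex.
From mathcomp Require Import normedtype.
From mathcomp Require Import ring lra.

Import Order.TTheory GRing.Theory Num.Theory.
Import numFieldNormedType.Exports.

Local Open Scope classical_set_scope.
Local Open Scope ring_scope.

(** Write f = g - h.  Stationarity says that every subgradient of h at x is a
    subgradient of g + delta_C at x.

    A local solution is stationary because the two subgradient inequalities
    compare g and h along segments: if u is a subgradient of h at x and y is in
    C, then at a point x + t (y - x) close to x local optimality bounds the
    growth of h by the growth of g, which is at most t (g y - g x) by
    convexity; dividing by t gives u (y - x) <= g y - g x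
    (local_solution_subdifferential).

    The converse rests on polyhedrality.  The epigraph of h is stable under
    upward translations, so every affine subspace containing it is vertical
    and the epigraph consists of the (y, s) such that y lies in a closed affine subspace M and
    v_k y + c_k s <= a_k for finitely many k, with c_k <= 0
    (epi_polyhedral_form).  Given y in C close to x with g y finite, the aim is
    that (y, h x + g y - g x) lies in the epigraph of h, since this says that
    f x <= f y.  Each constraint is handled separately.
    - If k is active at (x, h x) and c_k < 0, then - v_k / c_k is a subgradient
      of h at x, hence of g + delta_C, which is the wanted inequality.
    - If k is active and c_k = 0, or if v_k is replaced by a functional
      constant on M, then it is nonpositive on dom h - x.  Arbitrarily large
      multiples of it can be added to a subgradient of h, which must remain a
      subgradient of g + delta_C; so it is also nonpositive on
      (C and dom g) - x (stationary_normal).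
    - This also puts y in M: otherwise the Hahn-Banach theorem gives a
      continuous functional vanishing on M - x and positive at y - x
      (affine_separation), which the previous point excludes.
    - If k is inactive, the constraint persists near x, uniformly in
      g y - g x: by c_k <= 0 it is enough to check it with g y - g x replaced by
      the lower bound u0 (y - x), where u0 is any subgradient of h at x, and
      this last expression is continuous in y.
    Such a u0 exists because h x, being finite, is the least height s with
    (x, s) in the epigraph, so that some active constraint has c_k < 0
    (active_slope).

    The equivalence thus holds at every point of C where g and h are finite,
    and both parts of the theorem are instances of it. *)

(** * Convex sets and the Hahn-Banach theorem *)

Lemma convex_setP (R : realType) (E : lmodType R)
    (A : set (convex_lmodType E)) :
  convex_set A <-> forall (x y : E) (t : R), 0 <= t -> t <= 1 ->
    A x -> A y -> A (t *: x + (1 - t) *: y).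
Proof.
split=> [cA x y t t0 t1 Ax Ay|cA x y t].
  exact/set_mem/(cA x y (Itv01 t0 t1) (mem_set Ax) (mem_set Ay)).
by move=> /set_mem Ax /set_mem Ay; apply/mem_set/cA.
Qed.

Section HahnBanach.
Set Implicit Arguments.
Unset Strict Implicit.
Context (R : realType) (E : lmodType R).

(** Partial linear functionals are handled through their graphs, so that unions
    of chains and one-dimensional extensions are plain set operations. *)
Definition linear_graph (G : set (E * R^o)) : Prop :=
  forall (a : R) (p q : E * R^o), G p -> G q -> G (a *: p + q).

(** Domination by the gauge of W, expressed without the gauge.  When W is
    absorbing it also makes a linear graph single-valued, since multiples of a
    vertical vector would exceed 1 over the origin. *)
Definition graph_le1_on (W : set E) (G : set (E * R^o)) : Prop :=
  forall (x : E) (r : R), G (x, r : R^o) -> W x -> r <= 1.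

Definition absorbing (W : set E) : Prop :=
  forall x : E, exists2 e : R, 0 < e & W (e *: x).

Lemma linear_graph0 (G : set (E * R^o)) :
  G !=set0 -> linear_graph G -> G (0, 0).
Proof.
move=> [p Gp] linG; have := linG (-1) p p Gp Gp.
by rewrite scaleN1r addNr.
Qed.

Lemma linear_graph_scale (G : set (E * R^o)) (a : R) (p : E * R^o) :
  linear_graph G -> G p -> G (a *: p).
Proof.
move=> linG Gp; rewrite -[a *: p]addr0; apply: (linG) => //.
by apply: linear_graph0 => //; exists p.
Qed.

(** The value c at x0 must satisfy (s - 1) / t <= c <= (1 - s') / t' whenever
    y - t x0 and y' + t' x0 are in W, with s and s' the values at y and y'.
    Every lower bound is below every upper bound because the convex combination
    of these two points that eliminates x0 is in W, where the bound by 1 is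
    known; so the supremum of the lower bounds will do. *)
Lemma graph_le1_extend (W : set (convex_lmodType E)) (G : set (E * R^o))
    (x0 : E) :
  convex_set W -> absorbing W -> G !=set0 -> linear_graph G ->
  graph_le1_on W G ->
  exists c : R, graph_le1_on W
    [set p | exists2 q, G q & exists t : R, p = t *: (x0, c : R^o) + q].
Proof.
move=> /convex_setP cW absW G0 linG leG.
pose lower := [set b : R | exists (y : E) (s t : R),
  [/\ G (y, s : R^o), 0 < t, W (y - t *: x0) & b = (s - 1) / t]].
have lower_le (y : E) (s t : R) : G (y, s : R^o) -> 0 < t -> W (y + t *: x0) ->
    ubound lower ((1 - s) / t).
  move=> Gy t0 Wy _ [y' [s' [t' [Gy' t'0 Wy' ->]]]].
  have tt0 : 0 < t + t' by rewrite addr_gt0.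
  have : (t + t')^-1 * (t' * s + t * s') <= 1.
    apply: (leG ((t + t')^-1 *: (t' *: y + t *: y'))).
      have := linG t' _ _ Gy (linear_graph_scale t linG Gy').
      by move=> /(linear_graph_scale (t + t')^-1 linG).
    (* The weights t' and t, normalized, cancel the two multiples of x0. *)
    have -> : (t + t')^-1 *: (t' *: y + t *: y') =
        t' / (t + t') *: (y + t *: x0) + (1 - t' / (t + t')) *: (y' - t' *: x0).
      have -> : 1 - t' / (t + t') = t / (t + t') by field; rewrite gt_eqF.
      rewrite ![_ / (t + t')]mulrC -!scalerA -scalerDr; congr (_ *: _).
      by rewrite !scalerDr scalerN !scalerA (mulrC t' t) addrACA subrr addr0.
    apply: cW => //; first by rewrite divr_ge0 // ltW.
    by rewrite ler_pdivrMr// mul1r lerDr ltW.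
  rewrite ler_pdivrMl// ler_pdivrMr// mulrAC ler_pdivlMr//.
  lra.
have [e e0 We] := absW (- x0).
have [e' e'0 We'] := absW x0.
have G00 := linear_graph0 G0 linG.
have lower_neq0 : lower !=set0.
  exists ((0 - 1) / e), 0, 0, e; split => //.
  by rewrite sub0r -scalerN.
have lower_ub : has_ubound lower.
  exists ((1 - 0) / e'); apply: (lower_le 0) => //.
  by rewrite add0r.
exists (sup lower) => _ r [[y s] Gy [t [-> ->]]] /= Wx.
have [t0|t0|t0] := ltgtP t 0.
- have : (s - 1) / - t <= sup lower.
    apply: ub_le_sup => //; exists y, s, (- t); split => //.
      by rewrite oppr_gt0.
    by rewrite scaleNr opprK addrC.
  rewrite ler_pdivrMr ?oppr_gt0// /GRing.scale/=; lra.
- have : sup lower <= (1 - s) / t.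
    apply: ge_sup => //; apply: (lower_le y) => //.
    by rewrite addrC.
  rewrite ler_pdivlMr// /GRing.scale/=; lra.
- rewrite t0 scale0r add0r; apply: (leG y) => //.
  by move: Wx; rewrite t0 scale0r add0r.
Qed.

(** Hahn-Banach extension with a convex absorbing set in place of a sublinear
    functional. *)
Theorem hahn_banach (W : set (convex_lmodType E)) (G0 : set (E * R^o)) :
  convex_set W -> absorbing W ->
  G0 !=set0 -> linear_graph G0 -> graph_le1_on W G0 ->
  exists f : {linear E -> R^o},
    (forall x r, G0 (x, r) -> f x = r) /\ forall x : E, W x -> f x <= 1 :> R.
Proof.
move=> cW absW G0n linG0 leG0.
(* The empty graph is admitted since it is the union of the empty chain. *)
pose P := [set G : set (E * R^o) |
  [/\ G !=set0 -> G0 `<=` G, linear_graph G & graph_le1_on W G]].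
have [|G [[G0G linG leG] maxG]] := @Zorn_bigcup _ P.
  move=> F FP totF; split.
  + move=> [p [G FG Gp]] q G0q; exists G => //.
    by have [G0G _ _] := FP G FG; apply: G0G => //; exists p.
  + move=> a p q [G1 FG1 G1p] [G2 FG2 G2q].
    have [G12|G21] := totF _ _ FG1 FG2.
      exists G2 => //; have [_ linG _] := FP G2 FG2.
      by apply: linG; first exact: G12.
    exists G1 => //; have [_ linG _] := FP G1 FG1.
    by apply: linG; last exact: G21.
  + by move=> x r [G FG Gx]; have [_ _ leG] := FP G FG; exact: leG Gx.
have G0subG : G0 `<=` G.
  apply: G0G; apply: contrapT => /nonemptyPn Ge.
  have [p G0p] := G0n; apply: (maxG G0); last by split => // _.
  by rewrite Ge; split; [exact: sub0set|move=> /(_ p G0p)].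
have Gn : G !=set0 by have [p /G0subG Gp] := G0n; exists p.
have G00 := linear_graph0 Gn linG.
have Gtot (x : E) : exists r : R, G (x, r : R^o).
  apply: contrapT => Gx.
  have [c leGc] := graph_le1_extend x cW absW Gn linG leG.
  set G' := [set p | _] in leGc.
  have GG' : G `<=` G'.
    by move=> q Gq; exists q => //; exists 0; rewrite scale0r add0r.
  apply: (maxG G'); split => //.
  + move=> G'G; apply: Gx; exists c; apply: G'G.
    by exists (0, 0) => //; exists 1; rewrite scale1r addr0.
  + by move=> _; exact: subset_trans GG'.
  + move=> a _ _ [p Gp [t ->]] [q Gq [t' ->]]; exists (a *: p + q).
      exact: linG.
    exists (a * t + t').
    by rewrite scalerDr scalerA scalerDl addrACA.
have Gfun (x : E) (r s : R) : G (x, r : R^o) -> G (x, s : R^o) -> r = s.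
  move=> Gr Gs; apply/eqP; rewrite -subr_eq0; apply/eqP.
  have := linG (-1) _ _ Gs Gr; rewrite /= => Grs.
  have {}Grs : G (0, (r - s) : R^o).
    by move: Grs; congr G; congr pair; rewrite /= scaleN1r addrC ?subrr.
  have [e e0 W0] := absW 0.
  have {e0}W0 : W 0 by move: W0; rewrite scaler0.
  apply/eqP/negPn/negP => rs0.
  have := linear_graph_scale (2 / (r - s)) linG Grs.
  move=> /leG; rewrite scaler0 => /(_ W0); rewrite /GRing.scale/= divfK//.
  by lra.
have /choice[f Gf] := Gtot.
have linf : linear (f : E -> R^o).
  move=> a x y; apply: (Gfun (a *: x + y)) => //.
  exact: linG a (x, f x : R^o) (y, f y : R^o) (Gf x) (Gf y).
pose L := GRing.isLinear.Build R E R^o _ f linf.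
pose F : {linear E -> R^o} := HB.pack f L.
exists F; split => [x r /G0subG Gx|x Wx].
  exact: Gfun Gx.
exact: leG Wx.
Qed.
End HahnBanach.

(** * Separating a point from a closed affine subspace *)

Section Separation.
Context (R : realType) (X : tvsType R).
Set Implicit Arguments.
Unset Strict Implicit.

Lemma affine_subspaceD (M : set X) (p q r : X) :
  affine_subspace M -> M p -> M q -> M r -> M (p + (q - r)).
Proof.
move=> affM Mp Mq Mr.
have Mpq := affM _ _ 2^-1 Mp Mq.
have := affM _ _ (-1) Mpq Mr.
have half : 1 - 2^-1 = 2^-1 :> R by lra.
have -> : 1 - -1 = 2 :> R by lra.
rewrite half scalerDr !scalerA divff ?pnatr_eq0// !scale1r scaleN1r.
by rewrite -addrA.
Qed.

Let cvg_add (T : Type) (F : set_system T) (FF : Filter F) (f g : T -> X)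
    (a b : X) :
  f @ F --> a -> g @ F --> b -> (fun t => f t + g t) @ F --> a + b.
Proof.
move=> fa gb.
exact: (@continuous2_cvg _ _ _ _ _ FF f g (fun u v : X => u + v) a b
  (@add_continuous X (a, b)) fa gb).
Qed.

Let cvg_scale (T : Type) (F : set_system T) (FF : Filter F) (f : T -> R^o)
    (g : T -> X) (a : R^o) (b : X) :
  f @ F --> a -> g @ F --> b -> (fun t => f t *: g t) @ F --> a *: b.
Proof.
move=> fa gb.
exact: (@continuous2_cvg _ _ _ _ _ FF f g (fun (u : R^o) (v : X) => u *: v)
  a b (@scale_continuous R X (a, b)) fa gb).
Qed.

Lemma affine_map_continuous (a b : X) (c : R) :
  continuous (fun w : X => a + c *: (w - b)).
Proof.
move=> w; apply: cvg_add; first exact: cvg_cst.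
apply: cvg_scale; first exact: cvg_cst.
by apply: cvg_add; [exact: cvg_id|exact: cvg_cst].
Qed.

Lemma near_right_ray (U : set X) (x d : X) :
  nbhs x U -> \forall t \near (0 : R)^'+, U (x + t *: d).
Proof.
move=> Ux.
have cvx : (fun t : R^o => x + t *: d) @ (0 : R^o) --> x.
  rewrite -{2}[x]addr0 -(scale0r d).
  apply: cvg_add; first exact: cvg_cst.
  by apply: cvg_scale; [exact: cvg_id|exact: cvg_cst].
by apply: cvg_within; exact: cvx.
Qed.

Lemma nbhs0_absorbing (W : set X) : nbhs 0 W -> absorbing W.
Proof.
move=> W0 x.
have : \forall t \near (0 : R)^'+, 0 < t /\ W (t *: x).
  near=> t; split; first by near: t; exact: nbhs_right_gt.
  by rewrite -[_ *: _]add0r; near: t; exact: near_right_ray.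
by move=> /filter_ex[t [t0 Wt]]; exists t.
Unshelve. all: by end_near. Qed.

Lemma near0_scaled (B : set X) (a : X) (c : R) :
  nbhs 0 B -> \forall w \near a, B (c *: (w - a)).
Proof.
have := @affine_map_continuous 0 a c a.
rewrite /continuous_at subrr scaler0 addr0 => cvB /cvB.
by under [X in X @ _]eq_fun do rewrite add0r.
Qed.

(** Apply the bound to the multiples of w - a by 2 / e and - 2 / e, which
    both lie in B when w is close to a. *)
Lemma linear_le1_continuous (B : set X) (f : {linear X -> R^o}) :
  nbhs 0 B -> (forall x, B x -> f x <= 1 :> R) -> continuous f.
Proof.
move=> B0 fB; move=> a; apply/cvgrPdist_lt => e e0.
near=> w.
have Bp : B ((2 / e) *: (w - a)) by near: w; exact: near0_scaled.
have Bn : B ((- (2 / e)) *: (w - a)) by near: w; exact: near0_scaled.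
have fE (c : R) : f (c *: (w - a)) = c * (f w - f a) :> R.
  by rewrite linearZ linearB.
have := fB _ Bp; have := fB _ Bn; rewrite !fE mulNr mulrAC.
set d := f w - f a => dn dp.
rewrite distrC -/d ltr_norml; apply/andP; split.
  move: dn; rewrite -mulNr ler_pdivrMr// => dn; lra.
move: dp; rewrite ler_pdivrMr//; lra.
Unshelve. all: by end_near. Qed.

(** Take a convex neighborhood B of 0 such that y - B misses M.  Then
    W = B + (M - x) is convex and does not contain y - x, so the functional
    mapping y - x to 1 on its line is at most 1 on W and extends.  The extension
    is bounded above by 1 on B, hence continuous, and on the linear subspace
    M - x, hence zero there. *)
Theorem affine_separation (M : set X) (x y : X) :
  closed M -> affine_subspace M -> M x -> ~ M y ->
  exists f : {linear X -> R^o},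
    [/\ continuous f, forall m, M m -> f (m - x) = 0 & 0 < f (y - x) :> R].
Proof.
move=> clM affM Mx My.
have [BB cB [oB basB]] := @locally_convex R X.
have [B [BBB B0 BM]] : exists B, [/\ BB B, B 0 & forall b, B b -> ~ M (y - b)].
  have nM : nbhs 0 [set b | ~ M (y - b)].
    have := @affine_map_continuous y 0 (-1) 0.
    rewrite /continuous_at subrr scaler0 addr0 => cvM.
    have /cvM : nbhs y (~` M).
      by apply: open_nbhs_nbhs; split => //; exact: closed_openC.
    by under [X in X @ _]eq_fun do rewrite subr0 scaleN1r.
  have [B [BBB B0] BM] := basB 0 _ nM.
  by exists B.
have {}cB := (convex_setP _ _ _).1 (cB B (mem_set BBB)).
have nB : nbhs 0 B by apply: open_nbhs_nbhs; split => //; exact: oB.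
pose W : set X := [set w | exists2 b, B b & M (x + w - b)].
have BW : B `<=` W by move=> b Bb; exists b => //; rewrite addrK.
have cW : convex_set (W : set (convex_lmodType X)).
  apply/convex_setP => w w' t t0 t1 [b Bb Mb] [b' Bb' Mb'].
  exists (t *: b + (1 - t) *: b'); first exact: cB.
  have := affM _ _ (1 - t) Mb Mb'.
  have -> : 1 - (1 - t) = t by lra.
  congr M.
  rewrite !(scalerDr, scalerN) addrACA; congr (_ + _); last by rewrite opprD.
  by rewrite addrACA -scalerDl [t + _]addrC subrK scale1r.
have nWyx : ~ W (y - x).
  by move=> [b Bb]; rewrite [x + _]addrC subrK; exact: BM.
have W0 : W 0 by exact: BW.
pose G : set (X * R^o) := [set p | exists t : R, p = (t *: (y - x), t : R^o)].
have [||||f [fG fW]] := @hahn_banach R X W G cW.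
- by apply: nbhs0_absorbing; exact: filterS nB.
- by exists (0, 0); exists 0; rewrite scale0r.
- move=> a _ _ [t ->] [s ->]; exists (a * t + s).
  by rewrite scalerDl -scalerA.
- move=> _ r [t [-> ->]] Wt; rewrite leNgt; apply/negP => t1.
  have t0 : 0 < t by exact: lt_trans t1.
  apply: nWyx.
  have := (convex_setP _ _ _).1 cW _ _ t^-1 _ _ Wt W0.
  rewrite scaler0 addr0 scalerA mulVf ?gt_eqF// scale1r; apply.
    by rewrite invr_ge0 ltW.
  by rewrite invf_le1 // ltW.
exists f; split.
- apply: (@linear_le1_continuous B) => // b /BW; exact: fW.
- move=> m Mm.
  have fle (a : R) : a * (f (m - x) : R) <= 1.
    rewrite -[_ * _]/(a *: f (m - x)) -linearZ; apply: fW.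
    exists 0 => //; rewrite subr0.
    have := affM _ _ a Mx Mm; congr M.
    by rewrite scalerBl scale1r scalerBr -!addrA (addrC (- _)).
  apply/eqP/negPn/negP => f0.
  have := fle (2 / f (m - x)); rewrite divfK//; lra.
- by rewrite (fG _ 1)//; exists 1; rewrite scale1r.
Qed.
End Separation.

(** * Generalized polyhedral functions and their subgradients *)

Section PolyhedralFunctions.
Context (R : realType) (X : tvsType R).
Set Implicit Arguments.
Unset Strict Implicit.
Implicit Types (phi g h : X -> \bar R) (C : set X) (x y : X).

Lemma dom_proper_fin phi x :
  proper_fun phi -> dom phi x -> exists r : R, phi x = r%:E.
Proof.
move=> [_ /(_ x)]; rewrite /dom/=.
by case: (phi x) => [r _ _|//|//]; exists r.
Qed.

Lemma linear_combination (f g : {linear X -> R^o}) (a b : R) :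
  continuous f -> continuous g ->
  exists F : {linear X -> R^o},
    continuous F /\ forall x, F x = a * f x + b * g x :> R.
Proof.
move=> cf cg.
have linF : linear (fun x => a * f x + b * g x : R^o).
  move=> t x y; rewrite (linearP f) (linearP g).
  suff : a * (t * f x + f y) + b * (t * g x + g y) =
    t * (a * f x + b * g x) + (a * f y + b * g y) :> R by exact.
  by ring.
pose F : {linear X -> R^o} :=
  HB.pack (fun x => a * f x + b * g x : R^o)
    (GRing.isLinear.Build R X R^o _ _ linF).
exists F; split => // x.
apply: (@cvgD R R^o).
  by apply: (@cvgMr R); exact: cf.
by apply: (@cvgMr R); exact: cg.
Qed.

(** The points (x0, r0 + n), n >= 0, of the epigraph make the affine subspace L
    invariant under vertical translations, so that L = M * R with M its section
    at height 0; they also violate any constraint with a positive slope in the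
    last variable. *)
Theorem epi_polyhedral_form h : proper_fun h -> gen_polyhedral_fun h ->
  exists (M : set X) (p : nat) (v : 'I_p -> {linear X -> R^o})
      (c a : 'I_p -> R),
    [/\ closed M, affine_subspace M, forall k, continuous (v k),
      forall k, c k <= 0 &
      forall y (s : R), epi h (y, s : R^o) <->
        M y /\ forall k, v k y + c k * s <= a k].
Proof.
move=> hP [L [p [u [a [clL affL cu epiE]]]]].
have [x0 dx0] := hP.1.
have [r0 hx0] := dom_proper_fin hP dx0.
have epi_up (n : R) : 0 <= n -> epi h (x0, r0 + n : R^o).
  by move=> n0; split => //=; rewrite hx0 lee_fin lerDl.
have L_vert y (s t : R) : L (y, s : R^o) -> L (y, t : R^o).
  move=> Ls.
  (* Only points above r0 are known to be in L, so the translation by t - s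
     is obtained as a difference of two large heights. *)
  pose n := `|s| + `|t|.
  have Lx (e : R) : `|e| <= n -> L (x0, r0 + (n + e) : R^o).
    move=> en; have := epi_up (n + e); rewrite epiE => /(_ _)[] //.
    by move: en; rewrite ler_norml; lra.
  have := affine_subspaceD affL Ls (Lx t _) (Lx s _).
  rewrite /n lerDr lerDl => /(_ (normr_ge0 _) (normr_ge0 _)).
  congr L; congr pair => /=; first by rewrite subrr addr0.
  by lra.
have linv k : linear (fun y => u k (y, 0 : R^o)).
  move=> t y z; rewrite -linearP; congr (u k _); congr pair => //=.
  by rewrite scaler0 addr0.
pose v k : {linear X -> R^o} :=
  HB.pack (fun y => u k (y, 0 : R^o))
    (GRing.isLinear.Build R X R^o _ _ (linv k)).
pose c k : R := u k (0, 1 : R^o).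
have uE k y (s : R) : u k (y, s : R^o) = v k y + c k * s :> R.
  have -> : (y, s : R^o) = s *: (0, 1 : R^o) + (y, 0) :> X * R^o.
    by congr pair => /=; rewrite ?scaler0 ?add0r// addr0 /GRing.scale/= mulr1.
  by rewrite linearP addrC [c k * s]mulrC.
have pair0_continuous : continuous (fun y : X => (y, 0 : R^o)).
  move=> y; have := @cvg_pair X X R^o (nbhs y) (nbhs y) (nbhs (0 : R^o)) _ _ _
    id (fun=> 0 : R^o).
  by apply; [exact: cvg_id|exact: cvg_cst].
have epiE' y (s : R) : epi h (y, s : R^o) <->
    L (y, 0 : R^o) /\ forall k, v k y + c k * s <= a k.
  rewrite epiE; split=> [[Ls uk]|[Ls uk]]; split.
  - exact: L_vert Ls.
  - by move=> k; rewrite -uE.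
  - exact: L_vert Ls.
  - by move=> k; rewrite uE.
exists [set y | L (y, 0 : R^o)], p, v, c, a; split => //.
- exact: (continuous_closedP _).1 pair0_continuous _ clL.
- move=> y z t /= Ly Lz; have := affL _ _ t Ly Lz; congr L.
  by congr pair => /=; rewrite !scaler0 addr0.
- by move=> k y; apply: continuous_comp; [exact: pair0_continuous|exact: cu].
- move=> k; rewrite leNgt; apply/negP => c0.
  have vle (n : R) : 0 <= n -> v k x0 + c k * (r0 + n) <= a k.
    by move=> /epi_up/epiE'[].
  have := vle 0 (lexx _); rewrite addr0 => vle0.
  have n0 : 0 <= (a k - v k x0 - c k * r0) / c k + 1.
    by rewrite addr_ge0// divr_ge0 ?(ltW c0)//; lra.
  have := vle _ n0; rewrite !mulrDr mulrCA divff ?gt_eqF//; lra.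
Qed.

(** Points of the epigraph have real heights, so testing subgradients on them
    turns the extended inequality into one between real numbers. *)
Lemma subdifferentialP phi x (r : R) (f : {linear X -> R^o}) :
  (forall y, (-oo < phi y)%E) -> phi x = r%:E ->
  subdifferential phi x f <->
  continuous f /\
  forall y (s : R), epi phi (y, s : R^o) -> f (y - x) <= s - r :> R.
Proof.
move=> phiP phix; split=> -[cf fle]; split => // y.
  move=> s [/= _ le_s]; have := fle y; rewrite phix => fy.
  rewrite -lee_fin EFinB; apply: le_trans fy _.
  by apply: leeB.
rewrite phix; have := phiP y; have := fle y; rewrite /epi /dom/=.
case: (phi y) => [s fy _|_ _|_ //].
  by rewrite -EFinB lee_fin; apply: fy; rewrite ltry.
by rewrite leey.
Qed.

Lemma epi_add_indicator g C y (s : R) : (-oo < g y)%E ->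
  epi (g \+ indicator C)%E (y, s : R^o) <-> C y /\ epi g (y, s : R^o).
Proof.
rewrite /epi /dom /indicator/= => gy; case: ifPn => [/set_mem Cy|/negP Cy].
  by rewrite adde0; tauto.
rewrite addey ?gt_eqF//; split=> [[]//|[Cy']].
by case: Cy; exact/mem_set.
Qed.

Lemma add_indicator_proper g C y : (-oo < g y)%E ->
  (-oo < (g \+ indicator C)%E y)%E.
Proof.
move=> gy; rewrite /indicator/=; case: ifP => _; first by rewrite adde0.
by rewrite addey ?gt_eqF// ltNyy.
Qed.

(** If all the active constraints were vertical, r could be lowered slightly. *)
Lemma active_slope (p : nat) (v c a : 'I_p -> R) (r : R) :
  (forall k, c k <= 0) -> (forall k, v k + c k * r <= a k) ->
  (forall s, (forall k, v k + c k * s <= a k) -> r <= s) ->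
  exists2 k, c k < 0 & v k + c k * r = a k.
Proof.
move=> c0 rle rmin; apply: contrapT => noactive.
have near_ok k : \forall e \near (0 : R)^'+, v k + c k * (r - e) <= a k.
  have [ck0|ck0] := ltP (c k) 0; last first.
    have ck : c k = 0 by apply/eqP; rewrite eq_le c0.
    by near=> e; have := rle k; rewrite ck !mul0r.
  have slack : 0 < (a k - v k - c k * r) / - c k.
    rewrite divr_gt0 ?oppr_gt0//.
    have : v k + c k * r != a k by apply/eqP => ?; apply: noactive; exists k.
    have := rle k; rewrite le_eqVlt => /predU1P[->|lt_ak _]; last by lra.
    by rewrite eqxx.
  near=> e.
  have : e < (a k - v k - c k * r) / - c k by near: e; exact: nbhs_right_lt.
  rewrite ltr_pdivlMr ?oppr_gt0//; lra.
have near_all : \forall e \near (0 : R)^'+,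
    forall k, v k + c k * (r - e) <= a k.
  exact: filter_forall.
have : \forall e \near (0 : R)^'+, False.
  near=> e.
  have e0 : 0 < e by near: e; exact: nbhs_right_gt.
  have : r <= r - e by apply: rmin; near: e; exact: near_all.
  by lra.
exact: filter_not_empty.
Unshelve. all: by end_near. Qed.

End PolyhedralFunctions.

(** * Local solutions and stationary points *)

Section Optimality.
Context (R : realType) (X : tvsType R).

Let linear_diff (f : {linear X -> R^o}) x y : f (x - y) = f x - f y :> R.
Proof. by rewrite linearB. Qed.

Set Implicit Arguments.
Unset Strict Implicit.
Implicit Types (g h : X -> \bar R) (C : set X) (x y : X).

(** Local optimality is used at a single point of the segment from x to y,
    close enough to x; convexity of g transfers the result to y. *)
Lemma local_solution_subdifferential g h C x :
  proper_fun g -> convex_fun g -> proper_fun h ->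
  convex_set (C : set (convex_lmodType X)) ->
  dom g x -> dom h x -> local_solutions g h C x ->
  subdifferential h x `<=` subdifferential (g \+ indicator C)%E x.
Proof.
move=> gP /convex_setP cg hP /convex_setP cC dgx dhx [Cx [U Ux minx]] f.
have [a gx] := dom_proper_fin gP dgx.
have [r hx] := dom_proper_fin hP dhx.
have gCx : (g \+ indicator C)%E x = a%:E.
  by rewrite /indicator/= mem_set// gx adde0.
have gC_proper y := add_indicator_proper C (gP.2 y).
rewrite (subdifferentialP _ hP.2 hx) (subdifferentialP _ gC_proper gCx).
move=> [cf fh]; split => // y s /(epi_add_indicator _ _ (gP.2 y))[Cy gys].
have [t t0 [t1 Uz]] : exists2 t : R,
    0 < t & t <= 1 /\ U (t *: y + (1 - t) *: x).
  have : \forall t \near (0 : R)^'+,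
      0 < t /\ (t <= 1 /\ U (t *: y + (1 - t) *: x)).
    near=> t; split; first by near: t; exact: nbhs_right_gt.
    split; first by near: t; exact: nbhs_right_le.
    have -> : t *: y + (1 - t) *: x = x + t *: (y - x).
      by rewrite scalerBl scale1r scalerBr addrCA.
    by near: t; exact: near_right_ray.
  by move=> /filter_ex[t [t0 ?]]; exists t.
set z := t *: y + (1 - t) *: x in Uz.
have Cz : C z by apply: cC => //; exact: ltW.
have gz : epi g (z, t * s + (1 - t) * a : R^o).
  have gxa : epi g (x, a : R^o) by split => //=; rewrite gx.
  exact: (cg _ _ t (ltW t0) t1 gys gxa).
(* If h were infinite at z, the objective would be -oo there. *)
have hz : epi h (z, t * s + (1 - t) * a - a + r : R^o).
  have [b gzb] := dom_proper_fin gP gz.1.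
  have bs : b <= t * s + (1 - t) * a by case: gz; rewrite /= gzb lee_fin.
  have := minx z (conj Cz Uz); rewrite /dc_objective gx hx gzb /epi /dom/=.
  have := hP.2 z; case: (h z) => [q|//|//] _ /=.
  by rewrite !lee_fin ltry => qle; split => //; move: qle; lra.
have : f (z - x) <= t * s + (1 - t) * a - a + r - r := fh _ _ hz.
have -> : z - x = t *: (y - x).
  by rewrite /z scalerBl scale1r scalerBr addrA addrAC addrK.
have -> : f (t *: (y - x)) = t * f (y - x) :> R by rewrite linearZ.
move=> fz.
by rewrite -(ler_pM2l t0); apply: le_trans fz _; lra.
Unshelve. all: by end_near. Qed.

(** Adding t * w to a subgradient u of h at x yields a subgradient of h for
    every t >= 0, hence one of g + delta_C, and u (y - x) + t * w (y - x) is
    bounded in t only if w (y - x) <= 0. *)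
Lemma stationary_normal g h C x (w : {linear X -> R^o}) :
  proper_fun g -> proper_fun h -> C x -> dom g x -> dom h x ->
  subdifferential h x !=set0 ->
  subdifferential h x `<=` subdifferential (g \+ indicator C)%E x ->
  continuous w -> (forall y, dom h y -> w (y - x) <= 0 :> R) ->
  forall y, C y -> dom g y -> w (y - x) <= 0 :> R.
Proof.
move=> gP hP Cx dgx dhx [u hu] stat cw wh y Cy dgy.
have [a gx] := dom_proper_fin gP dgx.
have [b gy] := dom_proper_fin gP dgy.
have [r hx] := dom_proper_fin hP dhx.
have gCx : (g \+ indicator C)%E x = a%:E.
  by rewrite /indicator/= mem_set// gx adde0.
have gC_proper z := add_indicator_proper C (gP.2 z).
have [cu uh] := (subdifferentialP _ hP.2 hx).1 hu.
have wle (t : R) : 0 <= t -> u (y - x) + t * w (y - x) <= b - a.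
  move=> t0; have [F [cF FE]] := linear_combination 1 t cu cw.
  have /stat/(subdifferentialP _ gC_proper gCx)[_ Fle] : subdifferential h x F.
    apply/(subdifferentialP _ hP.2 hx); split => // z s hz.
    rewrite FE mul1r; have := uh _ _ hz.
    have : t * w (z - x) <= 0 by apply: mulr_ge0_le0 => //; exact: wh hz.1.
    lra.
  have := Fle y b; rewrite FE mul1r; apply.
  apply/epi_add_indicator; first exact: gP.2.
  by split => //; split => //=; rewrite gy.
rewrite leNgt; apply/negP => w0.
have := wle 0 (lexx _) => wle0.
have t0 : 0 <= (b - a - u (y - x)) / w (y - x) + 1.
  rewrite addr_ge0// divr_ge0 ?(ltW w0)//; move: wle0; lra.
have := wle _ t0; rewrite mulrDl divfK ?gt_eqF// mul1r; move: w0; lra.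
Qed.

(** On the neighborhood U of x where the constraints inactive at (x, h x) hold
    at height h x + u0 (y - x), stationarity puts (y, h x + g y - g x) in the
    epigraph of h for every y of C at which g is finite. *)
Lemma subdifferential_local_solution g h C x :
  proper_fun g -> proper_fun h -> gen_polyhedral_fun h ->
  C x -> dom g x -> dom h x ->
  subdifferential h x `<=` subdifferential (g \+ indicator C)%E x ->
  local_solutions g h C x.
Proof.
move=> gP hP hpoly Cx dgx dhx stat.
have [M [p [v [c [al [clM affM cv c_le0 epiE]]]]]] :=
  epi_polyhedral_form hP hpoly.
have [a gx] := dom_proper_fin gP dgx.
have [r hx] := dom_proper_fin hP dhx.
have gCx : (g \+ indicator C)%E x = a%:E.
  by rewrite /indicator/= mem_set// gx adde0.
have gC_proper z := add_indicator_proper C (gP.2 z).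
have hxr : epi h (x, r : R^o) by split => //=; rewrite hx.
have [Mx vx] := (epiE _ _).1 hxr.
have subh k : c k < 0 -> v k x + c k * r = al k ->
    exists2 u : {linear X -> R^o}, subdifferential h x u &
      forall y, - c k * u y = v k y :> R.
  move=> ck0 act; have [F [cF FE]] :=
    linear_combination (- (c k)^-1) 0 (cv k) (cv k).
  have FE' y : - c k * F y = v k y :> R.
    by rewrite FE mul0r addr0 mulrA mulrNN divff ?mul1r// lt_eqF.
  exists F => //; apply/(subdifferentialP _ hP.2 hx); split => // y s.
  move=> /epiE[_ /(_ k) vy].
  have : - c k * F (y - x) <= - c k * (s - r).
    by rewrite FE' linear_diff; lra.
  by rewrite ler_pM2l// oppr_gt0.
have [k0 ck0 act0] : exists2 k, c k < 0 & v k x + c k * r = al k.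
  apply: (active_slope c_le0 vx) => s vs.
  by have [_ /=] := (epiE x s).2 (conj Mx vs); rewrite hx lee_fin.
have [u0 hu0 _] := subh _ ck0 act0.
have [cu0 _] := (subdifferentialP _ hP.2 hx).1 hu0.
have normal w cw wh := @stationary_normal g h C x w gP hP Cx dgx dhx
  (ex_intro _ _ hu0) stat cw wh.
have slope_le u y b : subdifferential h x u -> C y -> g y = b%:E ->
    u (y - x) <= b - a :> R.
  move=> /stat/(subdifferentialP _ gC_proper gCx)[_ ule] Cy gy; apply: ule.
  apply/epi_add_indicator; first exact: gP.2.
  by split => //; split; rewrite /dom/= gy ?ltry.
have domM y : dom h y -> M y.
  move=> dhy; have [s hy] := dom_proper_fin hP dhy.
  by have [] := (epiE y s).1 _; [split => //=; rewrite hy|].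
have CgM y : C y -> dom g y -> M y.
  move=> Cy dgy; apply: contrapT => My.
  have [w [cw wM wy]] := affine_separation clM affM Mx My.
  have := normal w cw _ y Cy dgy; rewrite leNgt wy => /(_ _)/negP; apply => //.
  by move=> z /domM/wM ->.
pose U : set X := [set y | forall k, v k x + c k * r < al k ->
  v k y + c k * (r + u0 (y - x)) < al k].
split => //; exists U.
  apply: filter_forall => k.
  have [F [cF FE]] := linear_combination 1 (c k) (cv k) cu0.
  have [slack|_] := boolP (v k x + c k * r < al k); last first.
    exact: nearW.
  have lim_lt : F x < al k - c k * r + c k * u0 x by rewrite FE; lra.
  have : \forall y \near x, F y < al k - c k * r + c k * u0 x :> R.
    by apply: (cvgr_lt (F x)); [exact: cF|exact: lim_lt].
  apply: filterS => y; rewrite FE linear_diff.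
  by move=> y_lt _; lra.
move=> y [Cy Uy]; rewrite /dc_objective gx hx.
have := gP.2 y; case gy: (g y) => [b| |] // _; last by rewrite /= leey.
have dgy : dom g y by rewrite /dom/= gy ltry.
have : epi h (y, r + (b - a) : R^o).
  apply/epiE; split; first exact: CgM.
  move=> k; have := vx k; rewrite le_eqVlt => /predU1P[act|slack].
  - have [ck|ck] := ltP (c k) 0.
    + have [u hu uE] := subh k ck act.
      have : v k (y - x) <= - c k * (b - a).
        by rewrite -uE ler_pM2l ?oppr_gt0//; exact: slope_le.
      rewrite linear_diff; lra.
    + have ckE : c k = 0 by apply/eqP; rewrite eq_le c_le0.
      have : v k (y - x) <= 0 :> R.
        apply: (normal (v k)) => // z dhz; have [s hz] := dom_proper_fin hP dhz.
        have [|_ /(_ k)] := (epiE z s).1 _; first by split => //=; rewrite hz.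
        by rewrite linear_diff; rewrite ckE in act *; lra.
      rewrite linear_diff ckE; rewrite ckE in act; lra.
  - have := Uy k slack.
    (* Raising the height from r + u0 (y - x) to r + (b - a) helps: c k <= 0. *)
    have := slope_le _ _ _ hu0 Cy gy; have := c_le0 k.
    move=> ck ule /ltW; apply: le_trans.
    by rewrite lerD2l ler_wnM2l// lerD2l.
move=> [dhy]; rewrite /=; have := hP.2 y; move: dhy; rewrite /dom/=.
case: (h y) => [q|//|//] _ _; rewrite !lee_fin /=; lra.
Qed.

End Optimality.

Theorem theorem3p3 (R : realType) (X : tvsType R) (hX : hausdorff_space X)
    (g h : X -> \bar R) (C : set X)
    (g_proper : proper_fun g) (g_convex : convex_fun g)
    (h_proper : proper_fun h) (h_polyhedral : gen_polyhedral_fun h)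
    (C_nonempty : C !=set0)
    (C_convex : convex_set (C : set (convex_lmodType X)))
    (gC_nonempty : (dom g `&` C) !=set0) :
  (forall x : X, (dom g `&` (dom h)° `&` C) x ->
     (local_solutions g h C x <->
      subdifferential h x `<=` subdifferential (g \+ indicator C)%E x)) /\
  local_solutions g h C `&` (dom g `&` dom h) = stationary_points g h C.
Proof.
have optimality x : C x -> dom g x -> dom h x ->
    (local_solutions g h C x <->
     subdifferential h x `<=` subdifferential (g \+ indicator C)%E x).
  move=> Cx dgx dhx; split; first exact: local_solution_subdifferential.
  exact: subdifferential_local_solution.
split=> [x [[dgx /interior_subset dhx] Cx]|]; first exact: optimality.
apply/seteqP; split=> x.
  move=> [xS [dgx dhx]]; have Cx : C x by case: xS.
  by split => //; apply/optimality.
by move=> [[[dgx dhx] Cx] stat]; split => //; apply/optimality.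
Qed.
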